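(* Let $Y$ be a real random variable with probability density function $f_Y$, let $\tau\in(0,1)$ and $\delta>0$, and let $\nu_\tau\in\mathbb{R}$ be the $\tau$th modile of $Y$ with $h_1=h_2=\delta$. Suppose that for every $x\in(0,\delta)$, $$\frac{f_Y(\nu_\tau+x)}{f_Y(\nu_\tau-x)}=\frac{1-\tau}{\tau}.$$ Then $$\frac{P(\nu_\tau\le Y\le \nu_\tau+\delta)}{P(\nu_\tau-\delta\le Y\le \nu_\tau)}=\frac{1-\tau}{\tau}$$ and $$\frac{E\{(Y-\nu_\tau)\,I(\nu_\tau\le Y\le \nu_\tau+\delta)\}}{E\{(\nu_\tau-Y)\,I(\nu_\tau-\delta\le Y\le \nu_\tau)\}}=\frac{1-\tau}{\tau}.$$ Moreover, in the limiting case $\delta\to\infty$ (that is, when $\nu_\tau$ does not depend on $\delta$ and the displayed condition on $f_Y$ holds for every $x>0$), $$\frac{P(Y\ge \nu_\tau)}{P(Y\le \nu_\tau)}=\frac{1-\tau}{\tau}$$ and, the expectations being finite, $$\frac{E\{(Y-\nu_\tau)\,I(Y\ge \nu_\tau)\}}{E\{(\nu_\tau-Y)\,I(Y\le \nu_\tau)\}}=\frac{1-\tau}{\tau}.$$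
   Context: $I(\cdot)$ denotes the indicator function. For $\tau\in(0,1)$ and fixed positive numbers $h_1,h_2$, the $\tau$th modile $\nu_\tau$ of a random variable $Y$ is $$\nu_\tau=\arg\min_{\theta\in\mathbb{R}} E\left[|\tau-I(Y\le\theta)|\cdot\{I(Y-\theta<-h_1)+I(Y-\theta>h_2)\}\right],$$ equivalently the minimizer over $\theta$ of $\tau P(Y>\theta+h_2)+(1-\tau)P(Y<\theta-h_1)$. Every ratio appearing is understood to have a nonzero denominator. *)

(* Defs.v *)
From HB Require Import structures.
From mathcomp Require Export all_boot all_order all_algebra.
From mathcomp Require Export all_classical all_reals all_analysis.
Export Order.TTheory GRing.Theory Num.Theory.
Export numFieldNormedType.Exports.

Set Implicit Arguments.
Unset Strict Implicit.
Unset Printing Implicit Defensive.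

Local Open Scope classical_set_scope.
Local Open Scope ring_scope.

Definition has_density (R : realType) (d : measure_display)
    (T : measurableType d) (P : probability T R) (Y : {RV P >-> R})
    (f : R -> R) : Prop :=
  [/\ measurable_fun setT f,
      forall y, 0 <= f y &
      forall A : set R, measurable A ->
        distribution P Y A =
          (\int[@lebesgue_measure R]_(y in A) (f y)%:E)%E].

Definition modile_risk (R : realType) (d : measure_display)
    (T : measurableType d) (P : probability T R) (Y : {RV P >-> R})
    (tau h1 h2 theta : R) : \bar R :=
  'E_P[fun w => (`|tau - \1_[set y | y <= theta] (Y w)| *
                (\1_[set u | u < - h1] (Y w - theta) +
                 \1_[set u | h2 < u] (Y w - theta)))%R]%E.

(* The set of minimizers over the real line: it may be empty or have several
   points, and [is_modile Y tau h1 h2 nu] says that nu is one of them. *)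
Definition is_modile (R : realType) (d : measure_display)
    (T : measurableType d) (P : probability T R) (Y : {RV P >-> R})
    (tau h1 h2 : R) : set R :=
  [set nu | forall theta : R,
     (modile_risk Y tau h1 h2 nu <= modile_risk Y tau h1 h2 theta)%E].

(* Main.v *)
From HB Require Import structures.
Require Import Defs.
From mathcomp Require Import measurable_realfun lra ring.

(** Write c := (1 - tau) / tau.  The hypothesis on the density compares the two
    sides of nu through the reflection y |-> 2 nu - y: it says that
    f y = c * f (2 nu - y) for almost every y in the window D to the right of nu
    (the exceptions are the end points, which are Lebesgue-null).  Since the
    reflection preserves Lebesgue measure, the law of Y on D is c times the
    reflected law ([law_reflect]), hence for every nonnegative k supported in D,
    E[k(Y)] = c * E[k(2 nu - Y)] ([expectation_reflect]).

    Taking k to be the indicator of D gives the ratio of probabilities, and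
    k y = (y - nu) * 1_D y gives the ratio of truncated first moments, because
    (2 nu - y) - nu = nu - y.  Dividing requires the right-hand expectation to
    be nonzero and finite.  It is positive because f and k(2 nu - .) are
    positive on an interval to the left of nu ([expectation_gt0]).  It is finite
    by boundedness for a bounded window, and by assumption in the limiting case.
    Both cases are instances of [mirrored_ratios], with D = [nu, nu + delta] and
    D = [nu, +oo). *)

Local Open Scope classical_set_scope.
Local Open Scope ring_scope.

(** * Null sets and reflections of Lebesgue measure *)

Lemma integral_eq0_measure0 {d : measure_display} {T : measurableType d}
    {R : realType} {mu : {measure set T -> \bar R}} {D : set T} {f : T -> R} :
  measurable D -> measurable_fun D f -> (forall x, D x -> 0 < f x) ->
  (\int[mu]_(x in D) (f x)%:E)%E = 0%E -> mu D = 0%E.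
Proof.
move=> mD mf f0 If0.
have mEf : measurable_fun D (EFin \o f) by exact/measurable_EFinP.
have /(ae_eq_integral_abs mu mD mEf) [N [mN muN0 DN]] :
    (\int[mu]_(x in D) `|(EFin \o f) x|)%E = 0%E.
  rewrite -If0; apply: eq_integral => x /set_mem/f0/ltW fx0.
  by rewrite gee0_abs// lee_fin.
apply: (subset_measure0 mD mN _ muN0) => x Dx; apply: DN => /= /(_ Dx) [fx0].
by have := f0 _ Dx; rewrite fx0 ltxx.
Qed.

Lemma measurable_reflect {R : realType} (a : R) :
  measurable_fun [set: R] (fun y : R => a - y).
Proof. exact: measurable_funB. Qed.

(** By uniqueness of Lebesgue measure, it is enough to compare the lengths of
    half-open intervals. *)
Lemma lebesgue_measure_reflect {R : realType} (a : R) (A : set R) :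
  measurable A -> @lebesgue_measure R ((fun y => a - y) @^-1` A) =
    @lebesgue_measure R A.
Proof.
move=> mA.
transitivity (pushforward lebesgue_measure
  ((fun y => a - y) : _ -> measurableTypeR R) A) => //.
apply/esym/lebesgue_measure_unique => //=; first exact: measurable_reflect.
move=> mrefl _ [[u v] _ <-] /=; rewrite /pushforward /=.
have -> : (fun y => a - y) @^-1` `]u, v] = `[a - v, a - u[%classic.
  by apply/seteqP; split=> y /=; rewrite !in_itv/=; lra.
(* The preimage is closed-open, which the length of an interval does not see. *)
rewrite !lebesgue_measure_itv/= !lte_fin ltrD2l ltrN2.
by case: ifP => // _; congr (_%:E); ring.
Qed.

(** * Laws with a density that is symmetric up to a factor *)

(** Integrate the pointwise relation over C, then change variables by the
    reflection, an involution that preserves Lebesgue measure. *)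
Lemma law_reflect {R : realType} {d : measure_display} {T : measurableType d}
    {P : probability T R} {Y : {RV P >-> R}} {f : R -> R}
    (c nu : R) (C : set R) : has_density Y f ->
  0 <= c -> measurable C ->
  {ae @lebesgue_measure R, forall y, C y -> f y = c * f (nu *+ 2 - y)} ->
  distribution P Y C =
    (c%:E * distribution P Y ((fun y => (nu *+ 2 - y)%R) @^-1` C))%E.
Proof.
move=> [mf f0 Yf] c0 mC fC.
pose rho : R -> R := fun y => nu *+ 2 - y.
have mrho : measurable_fun [set: R] rho by exact: measurable_reflect.
have rhoK : rho @^-1` (rho @^-1` C) = C.
  by apply/seteqP; split=> y /=; rewrite /rho opprB addrC subrK.
have mrC : measurable (rho @^-1` C) by rewrite -[X in measurable X]setTI; exact: mrho.
have mfrho : measurable_fun C (f \o rho).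
  by apply: (measurable_funS measurableT) => //; exact: measurableT_comp.
rewrite !Yf//.
transitivity (\int[@lebesgue_measure R]_(y in C) (c * f (rho y))%:E)%E.
  apply: ge0_ae_eq_integral => //.
  - apply/measurable_EFinP; exact: (measurable_funS measurableT (@subsetT _ C) mf).
  - exact/measurable_EFinP/measurable_funM.
  - by move=> y _; rewrite lee_fin.
  - by move=> y _; rewrite lee_fin mulr_ge0.
  - by apply: negligibleS fC => y /=; apply: contra_not => fy /fy ->.
under eq_integral do rewrite EFinM.
rewrite ge0_integralZl//; last 2 first.
- exact/measurable_EFinP.
- by move=> y _; rewrite lee_fin.
congr (_ * _)%E.
have := @ge0_integral_pushforward _ _ (measurableTypeR R) (measurableTypeR R)
  R rho mrho lebesgue_measure (rho @^-1` C) (EFin \o f) mrC.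
rewrite rhoK => /= <-; last 2 first.
- by apply/measurable_EFinP; exact: measurable_funS mf.
- by move=> y _; rewrite lee_fin.
apply: eq_measure_integral => A mA _.
exact: lebesgue_measure_reflect.
Qed.

Lemma expectation_law {R : realType} {d : measure_display} {T : measurableType d}
    {P : probability T R} (Y : {RV P >-> R}) 
    (k : R -> R) : measurable_fun [set: R] k ->
  (forall y, 0 <= k y) ->
  'E_P[fun w => (k (Y w))%R]%E = (\int[distribution P Y]_y (k y)%:E)%E.
Proof.
move=> mk k0; rewrite unlock [RHS]ge0_integral_distribution//.
exact/measurable_EFinP.
Qed.

(** If k(Y) had zero expectation, C would be null for the law of Y since k > 0
    there, so f would integrate to zero over C; as f > 0 there, C would be
    Lebesgue-null. *)
Lemma expectation_gt0 {R : realType} {d : measure_display} {T : measurableType d}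
    {P : probability T R} {Y : {RV P >-> R}} {f : R -> R}
    (k : R -> R) (C : set R) : has_density Y f ->
  measurable C -> (0 < @lebesgue_measure R C)%E ->
  (forall y, C y -> 0 < f y) ->
  measurable_fun [set: R] k -> (forall y, 0 <= k y) ->
  (forall y, C y -> 0 < k y) ->
  (0 < 'E_P[fun w => (k (Y w))%R])%E.
Proof.
move=> [mf f0 Yf] mC C0 fC mk k0 kC; rewrite expectation_law//.
apply: (@lt_le_trans _ _ (\int[distribution P Y]_(y in C) (k y)%:E)%E).
  2: { apply: ge0_subset_integral => //; first exact/measurable_EFinP.
       by move=> y _; rewrite lee_fin. }
rewrite lt0e integral_ge0 ?andbT; last by move=> y _; rewrite lee_fin.
apply/eqP => kC0.
suff C00 : lebesgue_measure C = 0%E by rewrite C00 ltxx in C0.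
apply: (@integral_eq0_measure0 _ (measurableTypeR R) _ lebesgue_measure
  _ _ mC _ fC); first exact: measurable_funS mf.
rewrite -Yf//; apply: (integral_eq0_measure0 mC _ kC kC0).
exact: measurable_funS mk.
Qed.

(** On subsets of C the law of Y and c times the law of the reflected variable
    are the same measure, so they integrate k, which lives on C, equally. *)
Lemma expectation_reflect {R : realType} {d : measure_display} {T : measurableType d}
    {P : probability T R} {Y : {RV P >-> R}} {f : R -> R}
    (c nu : R) (k : R -> R) (C : set R) :
  has_density Y f -> 0 <= c -> measurable C ->
  {ae @lebesgue_measure R, forall y, C y -> f y = c * f (nu *+ 2 - y)} ->
  measurable_fun [set: R] k -> (forall y, 0 <= k y) ->
  (forall y, k y != 0 -> C y) ->
  'E_P[fun w => (k (Y w))%R]%E =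
    (c%:E * 'E_P[fun w => (k (nu *+ 2 - Y w))%R])%E.
Proof.
move=> Yf c0 mC fC mk k0 kC.
pose rho : R -> R := fun y => nu *+ 2 - y.
have mrho : measurable_fun [set: R] rho by exact: measurable_reflect.
have mkB (mu : {measure set R -> \bar R}) :
    (\int[mu]_y (k y)%:E = \int[mu]_(y in C) (k y)%:E)%E.
  rewrite [RHS]integral_mkcond; apply: eq_integral => y _; rewrite patchE.
  case: ifPn => //; rewrite notin_setE => yC.
  by have [->//|/kC] := eqVneq (k y) 0.
have mrY : measurable_fun [set: T] (rho \o Y) by exact: measurableT_comp.
pose rY : {RV P >-> R} :=
  HB.pack (rho \o Y) (isMeasurableFun.Build _ _ _ _ _ mrY).
rewrite (expectation_law rY)//.
rewrite expectation_law// !mkB -[c]/((NngNum c0)%:num).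
rewrite -ge0_integral_mscale//=; last 2 first.
- by apply/measurable_EFinP; exact: measurable_funS mk.
- by move=> y _; rewrite lee_fin.
apply: eq_measure_integral => A mA AB; rewrite /mscale /=.
apply: (law_reflect _ nu _ Yf) => //; apply: negligibleS fC => y /=.
by apply: contra_not => fy /AB; exact: fy.
Qed.


(** The real-valued form of [expectation_reflect].  The set C makes the
    denominator positive, and finiteness rules out the value +oo,
    which [fine] would send to 0. *)
Lemma fine_expectation_ratio {R : realType} {d : measure_display}
    {T : measurableType d} {P : probability T R} {Y : {RV P >-> R}} {f : R -> R}
    {c nu : R} (k : R -> R) (D C : set R) :
  has_density Y f -> 0 < c -> measurable C -> measurable D ->
  {ae @lebesgue_measure R, forall y, D y -> f y = c * f (nu *+ 2 - y)} ->
  (0 < @lebesgue_measure R C)%E ->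
  (forall y, C y -> 0 < f y) -> (forall y, C y -> 0 < k (nu *+ 2 - y)) ->
  measurable_fun [set: R] k -> (forall y, 0 <= k y) ->
  (forall y, k y != 0 -> D y) ->
  ('E_P[fun w => (k (nu *+ 2 - Y w))%R] < +oo)%E ->
  fine 'E_P[fun w => (k (Y w))%R]%E /
    fine 'E_P[fun w => (k (nu *+ 2 - Y w))%R]%E = c.
Proof.
move=> Yf c0 mC mD fD C0 fC kC mk k0 kD kfin.
have mkr : measurable_fun [set: R] (fun y => k (nu *+ 2 - y)).
  by apply: (measurableT_comp mk); exact: measurable_reflect.
have kgt0 := expectation_gt0 (fun y => k (nu *+ 2 - y)) C Yf mC C0 fC mkr
  (fun y => k0 _) kC.
rewrite (expectation_reflect c nu k D Yf (ltW c0) mD fD mk k0 kD).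
rewrite fineM//; last by rewrite ge0_fin_numE// ltW.
by rewrite /= mulfK// gt_eqF// fine_gt0// kgt0.
Qed.

(** * Probabilities and truncated moments on mirrored windows *)

Lemma expectation_indicator {R : realType} {d : measure_display}
    {T : measurableType d} {P : probability T R} (Y : {RV P >-> R}) (A : set R) :
  measurable A ->
  'E_P[fun w => (\1_A (Y w))%R]%E = P [set w | A (Y w)].
Proof.
move=> mA; rewrite expectation_law//.
by rewrite integral_indic// setIT.
Qed.

(** The common core of the bounded and limiting cases: D is a window to the
    right of nu, D' its mirror image, and e the width of a right neighbourhood
    of nu contained in D, on whose mirror image the density is positive. *)
Lemma mirrored_ratios {R : realType} {d : measure_display}
    {T : measurableType d} {P : probability T R} {Y : {RV P >-> R}} {f : R -> R}
    {c nu e : R} (D D' : set R) :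
  has_density Y f -> 0 < c -> measurable D -> 0 < e ->
  `]nu, nu + e[%classic `<=` D -> D `<=` `[nu, +oo[%classic ->
  {ae @lebesgue_measure R, forall y, D y -> f y = c * f (nu *+ 2 - y)} ->
  (forall x, 0 < x < e -> f (nu - x) != 0) ->
  (forall y, D' y <-> D (nu *+ 2 - y)) ->
  fine (P [set w | D (Y w)]) / fine (P [set w | D' (Y w)]) = c /\
  (('E_P[fun w => ((nu - Y w) * \1_D' (Y w))%R] < +oo)%E ->
   fine 'E_P[fun w => ((Y w - nu) * \1_D (Y w))%R]%E /
     fine 'E_P[fun w => ((nu - Y w) * \1_D' (Y w))%R]%E = c).
Proof.
move=> Yf c0 mD e0 eD Dnu fD fne0 D'E.
have -> : D' = (fun y => nu *+ 2 - y) @^-1` D.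
  by apply/seteqP; split=> y /D'E.
have [_ f0 _] := Yf.
pose C := `]nu - e, nu[%classic : set R.
have mC : measurable C by exact: measurable_itv.
have C0 : (0 < @lebesgue_measure R C)%E.
  by rewrite lebesgue_measure_itv/= lte_fin ifT ?lte_fin; lra.
have fC y : C y -> 0 < f y.
  rewrite /C/= in_itv/= => /andP[ey yn].
  rewrite lt0r f0 andbT (_ : y = nu - (nu - y)); last by ring.
  by apply: fne0; lra.
have CD y : C y -> D (nu *+ 2 - y).
  by rewrite /C/= in_itv/= => /andP[ey yn]; apply: eD => /=; rewrite in_itv/=; lra.
have mrho : measurable_fun [set: R] (fun y => nu *+ 2 - y) by exact: measurable_reflect.
have m1D : measurable_fun [set: R] (\1_D : R -> R) by exact: measurable_indic.
split.
- have mpre : measurable ((fun y : R => nu *+ 2 - y) @^-1` D).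
    by rewrite -[X in measurable X]setTI; exact: mrho.
  have PE : P [set w | ((fun y => nu *+ 2 - y) @^-1` D) (Y w)] =
      'E_P[fun w => (\1_D (nu *+ 2 - Y w))%R]%E.
    exact/esym/(expectation_indicator Y _ mpre).
  rewrite -expectation_indicator// PE.
  apply: (fine_expectation_ratio (f := f) (\1_D) D C) => //.
  + by move=> y /CD yD; rewrite indicE mem_set.
  + by move=> y; rewrite indicE; case: (boolP (y \in D)) => [/set_mem//|_]; rewrite eqxx.
  + rewrite -PE (le_lt_trans (probability_le1 P _)) ?ltry//.
    by rewrite -[X in measurable X]setTI; exact: (measurable_funP Y _ _ mpre).
- pose k (y : R) := (y - nu) * \1_D y.
  have -> : (fun w => (nu - Y w) * \1_((fun y => nu *+ 2 - y) @^-1` D) (Y w)) =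
            (fun w => k (nu *+ 2 - Y w)).
    by apply/funext => w; rewrite /k; congr (_ * _); ring.
  move=> kfin.
  apply: (fine_expectation_ratio (f := f) k D C) => //.
  + move=> y Cy; rewrite /k indicE mem_set ?mulr1; last exact: CD.
    by move: Cy; rewrite /C/= in_itv/=; lra.
  + by apply: measurable_funM => //; exact: measurable_funB.
  + move=> y; rewrite /k indicE; case: (boolP (y \in D)) => [/set_mem/Dnu|_].
      by rewrite /= in_itv/= mulr1; lra.
    by rewrite mulr0.
  + move=> y; rewrite /k indicE.
    by have [/set_mem|] := boolP (y \in D); rewrite ?mulr0 ?eqxx.
Qed.

Lemma density_reflect {R : realType} {f : R -> R} {c nu y : R} :
  f (nu - (y - nu)) != 0 /\ f (nu + (y - nu)) / f (nu - (y - nu)) = c ->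
  f y = c * f (nu *+ 2 - y).
Proof.
have -> : nu - (y - nu) = nu *+ 2 - y by ring.
have -> : nu + (y - nu) = y by ring.
by move=> [fy0 <-]; rewrite divfK.
Qed.

Lemma negligible_set1 {R : realType} (a : R) :
  (@lebesgue_measure R).-negligible [set a].
Proof. by exists [set a]; split => //; exact: lebesgue_measure_set1. Qed.

Lemma expectation_bounded_lty {R : realType} {d : measure_display}
    {T : measurableType d} {P : probability T R} (Y : {RV P >-> R})
    (k : R -> R) (M : R) :
  measurable_fun [set: R] k -> (forall y, 0 <= k y <= M) ->
  ('E_P[fun w => (k (Y w))%R] < +oo)%E.
Proof.
move=> mk kM; have k0 y : 0 <= k y by have /andP[] := kM y.
rewrite expectation_law//.
apply: (@le_lt_trans _ _ (\int[distribution P Y]_y (cst M%:E) y)%E).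
  apply: ge0_le_integral => //.
  - by move=> y _; rewrite lee_fin.
  - exact/measurable_EFinP.
  - by move=> y _; rewrite lee_fin; have /andP[] := kM y.
suff -> : (\int[distribution P Y]_y (cst M%:E) y = M%:E)%E by exact: ltry.
rewrite integral_cst// -[RHS]mule1; congr (_ * _)%E; exact: probability_setT.
Qed.

Theorem theorem1 (R : realType) (d : measure_display) (T : measurableType d)
    (P : probability T R) (Y : {RV P >-> R}) (f : R -> R) (tau : R) :
  has_density Y f -> 0 < tau < 1 ->
  (forall delta nu : R, 0 < delta ->
     is_modile Y tau delta delta nu ->
     (forall x : R, 0 < x < delta ->
        f (nu - x) != 0 /\ f (nu + x) / f (nu - x) = (1 - tau) / tau) ->
     fine (P [set w | nu <= Y w <= nu + delta]) /
       fine (P [set w | nu - delta <= Y w <= nu]) = (1 - tau) / tau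
     /\
     fine ('E_P[fun w => ((Y w - nu) *
              \1_[set y | nu <= y <= nu + delta] (Y w))%R]%E) /
       fine ('E_P[fun w => ((nu - Y w) *
              \1_[set y | nu - delta <= y <= nu] (Y w))%R]%E)
       = (1 - tau) / tau)
  /\
  (forall nu : R,
     (\forall delta \near +oo, is_modile Y tau delta delta nu) ->
     (forall x : R, 0 < x ->
        f (nu - x) != 0 /\ f (nu + x) / f (nu - x) = (1 - tau) / tau) ->
     fine (P [set w | nu <= Y w]) / fine (P [set w | Y w <= nu])
       = (1 - tau) / tau
     /\
     (('E_P[fun w => ((Y w - nu) * \1_[set y | nu <= y] (Y w))%R] < +oo)%E ->
      ('E_P[fun w => ((nu - Y w) * \1_[set y | y <= nu] (Y w))%R] < +oo)%E ->
      fine ('E_P[fun w => ((Y w - nu) * \1_[set y | nu <= y] (Y w))%R]%E) /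
        fine ('E_P[fun w => ((nu - Y w) * \1_[set y | y <= nu] (Y w))%R]%E)
        = (1 - tau) / tau)).

Proof.
move=> Yf /andP[tau0 tau1].
have c0 : 0 < (1 - tau) / tau by rewrite divr_gt0//; lra.
split.
- move=> delta nu delta0 _ fnu.
  pose D := [set y | nu <= y <= nu + delta].
  pose D' := [set y | nu - delta <= y <= nu].
  have mD : measurable D by rewrite /D -set_itvcc; exact: measurable_itv.
  have mD' : measurable D' by rewrite /D' -set_itvcc; exact: measurable_itv.
  have fD : {ae @lebesgue_measure R, forall y, D y ->
      f y = (1 - tau) / tau * f (nu *+ 2 - y)}.
    apply: negligibleS (negligibleU (negligible_set1 nu)
                                    (negligible_set1 (nu + delta))) => y /=.
    apply: contra_notP => /not_orP[/eqP ynu /eqP ynud] /andP[nuy ynude].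
    apply: density_reflect; apply: fnu.
    by rewrite subr_gt0 ltrBlDl !lt_neqAle nuy ynude ynud eq_sym ynu.
  have [] := mirrored_ratios D D' Yf c0 mD delta0 _ _ fD _ _.
  + by move=> y; rewrite /D/= !in_itv/=; lra.
  + by move=> y; rewrite /D/= !in_itv/=; lra.
  + by move=> x /fnu[].
  + by move=> y; rewrite /D /D' /=; split; lra.
  move=> PD ED; split; [exact: PD|apply: ED].
  (* On D' the factor nu - y lies between 0 and delta. *)
  apply: (expectation_bounded_lty Y (fun y => (nu - y) * \1_D' y) delta).
    apply: measurable_funM; [exact: measurable_reflect|exact: measurable_indic].
  move=> y; rewrite indicE; case: (boolP (y \in D')) => [/set_mem|_].
    by rewrite /D'/= mulr1; lra.
  by rewrite mulr0 lexx ltW.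
- move=> nu _ fnu.
  pose D := [set y | nu <= y].
  pose D' := [set y | y <= nu].
  have DE : D = `[nu, +oo[%classic by rewrite set_itvE.
  have mD : measurable D by rewrite DE; exact: measurable_itv.
  have fD : {ae @lebesgue_measure R, forall y, D y ->
      f y = (1 - tau) / tau * f (nu *+ 2 - y)}.
    apply: negligibleS (negligible_set1 nu) => y /=.
    apply: contra_notP => /eqP ynu nuy; apply: density_reflect; apply: fnu.
    by rewrite subr_gt0 lt_neqAle eq_sym ynu.
  have [] := mirrored_ratios D D' Yf c0 mD ltr01 _ _ fD _ _.
  + by move=> y; rewrite /D/= in_itv/=; lra.
  + by rewrite -DE.
  + by move=> x /andP[/fnu[]].
  + by move=> y; rewrite /D /D' /=; split; lra.
  by move=> PD ED; split => // _; exact: ED.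
Qed.
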